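(* We have the following identity modulo products \begin{equation*} \frac{7}{144}\,\mathrm{Gr}_4 \;\overset{\mathrm{sh}}{=}\; \mathrm{Alt}_8 \Big[ I_{3,1}\Big(\frac{\rho_{1,2}\rho_{3,4}}{\rho_{3,2}\rho_{1,4}},\frac{\rho_1}{\rho_{1,4}}\Big) +2I_{3,1}\Big(\frac{\rho_{1,2}}{\rho_1},\frac{\rho_{3,2}}{\rho_{3,4}}\Big) +6\,\mathrm{Li}_{4}\Big(\frac{\rho_1\rho_{3,2}}{\rho_{1,2}\rho_{3,4}}\Big)\Big]\,, \end{equation*} where we denote $\rho_{i,j}=\rho_i-\rho_j$.
   Context: $\mathrm{Gr}_4$ is Goncharov's (multivalued) Grassmannian $4$-logarithm, a function on configurations of $8$ vectors $v_1,\dots,v_8$ in general position in $\mathbb{C}^4$ modulo $\mathrm{GL}_4(\mathbb{C})$. Write $\langle i_1\dots i_4\rangle$ for the determinant with columns $v_{i_1},\dots,v_{i_4}$. For distinct $1\le i,j,k\le 6$ set $\rho_{ijk}=\langle ijk7\rangle/\langle ijk8\rangle$ and $\rho_i=\rho_{i,i+1,i+2}$ (indices mod $6$). $\mathrm{Alt}_8$ is the skew-symmetrization $\sum_{\sigma\in\mathfrak{S}_8}\mathrm{sgn}(\sigma)f(v_{\sigma(1)},\dots,v_{\sigma(8)})$. $I_{3,1}(x,y)=I(0;x,0,0,y;1)$ is the (motivic) iterated integral. For an element of weight $N$ with symbol $\mathcal{S}$ (the fully iterated $(N-1,1)$-part of the coproduct), define $\widetilde{\Pi}_1=\mathrm{id}$,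 $\widetilde{\Pi}_N(a_1\otimes\dots\otimes a_N)=\widetilde{\Pi}_{N-1}(a_1\otimes\dots\otimes a_{N-1})\otimes a_N-\widetilde{\Pi}_{N-1}(a_2\otimes\dots\otimes a_N)\otimes a_1$, and the mod-products symbol $\mathcal{S}^{\mathrm{sh}}=\widetilde{\Pi}_N\circ\mathcal{S}$. The notation $A\overset{\mathrm{sh}}{=}B$ means $\mathcal{S}^{\mathrm{sh}}(A)=\mathcal{S}^{\mathrm{sh}}(B)$, i.e. equality modulo products. *)

(* Defs.v *)
From HB Require Import structures.
From mathcomp Require Import all_boot all_order all_fingroup all_algebra.
From mathcomp Require Import finmap fraction complex reals.
From mathcomp.multinomials Require Import mpoly.

Set Implicit Arguments.
Unset Strict Implicit.
Unset Printing Implicit Defensive.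

Import GRing.Theory.
Local Open Scope ring_scope.

(* * The generic configuration *)

Section Generic.
Variable R : realType.

(* The field of rational functions on (C^4)^8. GL_4-invariant functions form a
   subfield L, and L^* (x) Q embeds in the units of the whole field tensor Q. *)
Definition config_field : fieldType := {fraction {mpoly R[i][4 * 8]}}.

Definition generic_config : 'M[config_field]_(4, 8) :=
  \matrix_(a < 4, k < 8) tofrac ('X_(mxvec_index a k) : {mpoly R[i][4 * 8]}).

End Generic.

(* mpoly and monalg shadow notations of each other, hence the late import. *)
From mathcomp.multinomials Require Import monalg.

(* The linear extension to the free vector space rat[K] of a map on its basis. *)
HB.lock Definition lin_ext (K : choiceType) (V : lmodType rat) (f : K -> V)
    (g : {malg rat[K]}) : V :=
  \sum_(k <- msupp g) monalg.mcoeff k g *: f k.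

(* * The tensor algebra of F^* (x) Q, presented by generators and relations *)

Section TensorAlgebra.
Variable F : fieldType.

Definition nonzero : Type := {x : F | x != 0}.
HB.instance Definition _ := Choice.on nonzero.
HB.instance Definition _ := SubType.on nonzero.

Definition tensor : Type := {malg rat[seq nonzero]}.
HB.instance Definition _ := GRing.Lmodule.on tensor.

(* The word [:: a_1; ...; a_N] stands for a_1 (x) ... (x) a_N. *)
Definition word (w : seq nonzero) : tensor := << w >>.

(* tensor_null is the subspace spanned by the multilinearity relations. The
   group law of the entries is multiplication, and torsion dies because
   coefficients are rational. *)
Inductive tensor_null : tensor -> Prop :=
| tensor_null0 : tensor_null 0
| tensor_null_lin (c : rat) (s t : tensor) :
    tensor_null s -> tensor_null t -> tensor_null (c *: s + t)
| tensor_null_mul (p q : seq nonzero) (x y z : nonzero) :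
    val z = val x * val y ->
    tensor_null (word (p ++ z :: q) - word (p ++ x :: q) - word (p ++ y :: q)).

Definition tensor_eq (s t : tensor) : Prop := tensor_null (s - t).

Definition tensor_rcons (t : tensor) (a : nonzero) : tensor :=
  lin_ext (fun w => word (rcons w a)) t.

Fixpoint Pi_rec (N : nat) (w : seq nonzero) : tensor :=
  match N, w with
  | N'.+1, a :: ((_ :: _) as s) =>
      tensor_rcons (Pi_rec N' (belast a s)) (last a s)
      - tensor_rcons (Pi_rec N' s) a
  | _, _ => word w
  end.

Definition Pi_sh (t : tensor) : tensor :=
  lin_ext (fun w => Pi_rec (size w) w) t.

Lemma one_nonzero : (1 : F) != 0. Proof. exact: oner_neq0. Qed.

(* Tangential regularisation log 0 := 0, i.e. 0 is replaced by 1. *)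
Definition reg (x : F) : nonzero := insubd (exist _ 1 one_nonzero : nonzero) x.

End TensorAlgebra.

(* * Polylogarithmic functions with arguments in F, and their symbols *)

Section Polylogarithms.
Variable F : fieldType.

Definition bracket (v : 'M[F]_(4, 8)) (i j k l : nat) : F :=
  \det (\matrix_(a < 4, b < 4) v a (inord (nth 0%N [:: i; j; k; l] b).-1)).

(* inl (a_0, s, a_(N+1)) is I(a_0; s; a_(N+1)), and inr v is Gr_4 at the
   configuration whose vectors are the columns of v. *)
Definition generator : Type := ((F * seq F * F) + 'M[F]_(4, 8))%type.
HB.instance Definition _ := Choice.on generator.

Definition polylog : Type := {malg rat[generator]}.
HB.instance Definition _ := GRing.Lmodule.on polylog.

Definition II (a0 : F) (s : seq F) (a1 : F) : polylog :=
  << (inl (a0, s, a1) : generator) >>.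

Definition Gr4 (v : 'M[F]_(4, 8)) : polylog := << (inr v : generator) >>.

Definition I31 (x y : F) : polylog := II 0 [:: x; 0; 0; y] 1.

(* Li_n(x) = - I(0; 1, 0, ..., 0; x). *)
Definition Li4 (x : F) : polylog := - II 0 [:: 1; 0; 0; 0] x.

(* The iterated (N-1,1)-part of the coproduct of motivic iterated integrals:
   I(a_0; a_1, ..., a_N; a_(N+1)) is sent to
     \sum_i I(a_0; ..., a_(i-1), a_(i+1), ...; a_(N+1))
              (x) I(a_(i-1); a_i; a_(i+1)),
   where I(a; b; c) is the logarithm of (c - b) / (a - b). *)
Fixpoint symbol_II (N : nat) (a0 : F) (s : seq F) (a1 : F) : tensor F :=
  if N is N'.+1 then
    let a i := nth 0 (a0 :: rcons s a1) i in
    \sum_(i < N'.+1)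
      let t := symbol_II N' a0 (take i s ++ drop i.+1 s) a1 in
      tensor_rcons t (reg (a i.+2 - a i.+1))
      - tensor_rcons t (reg (a i - a i.+1))
  else word [::].

(* Column k of col_perm s v is v_(s k). *)
Definition Alt8 (V : lmodType rat) (f : 'M[F]_(4, 8) -> V) (v : 'M[F]_(4, 8)) :
    V :=
  \sum_(s : 'S_8) (-1) ^+ s *: f (col_perm s v).

(* Gr_4 is the iterated integral attached to the integrable tensor
   Alt_8 (<1234> (x) <2345> (x) <3456> (x) <4567>), with the normalising factor
   2 (m!)^2 at m = 4. The symbol determines it modulo products. *)
Definition symbol_Gr4 (v : 'M[F]_(4, 8)) : tensor F :=
  (2 * 4`! ^ 2)%N%:R *:
    Alt8 (fun v => word [:: reg (bracket v 1 2 3 4); reg (bracket v 2 3 4 5);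
                            reg (bracket v 3 4 5 6); reg (bracket v 4 5 6 7)])
      v.

Definition symbol (A : polylog) : tensor F :=
  lin_ext (fun g : generator => match g with
                    | inl (a0, s, a1) => symbol_II (size s) a0 s a1
                    | inr v => symbol_Gr4 v
                    end) A.

Definition symbol_sh (A : polylog) : tensor F := Pi_sh (symbol A).

Definition eq_sh (A B : polylog) : Prop :=
  tensor_eq (symbol_sh A) (symbol_sh B).

(* Vectors are numbered 1, ..., 8, as in the brackets. *)
Definition rho3 (v : 'M[F]_(4, 8)) (i j k : nat) : F :=
  bracket v i j k 7 / bracket v i j k 8.

Definition cyc6 (i : nat) : nat := (i.-1 %% 6).+1.

Definition rho (v : 'M[F]_(4, 8)) (i : nat) : F :=
  rho3 v (cyc6 i) (cyc6 i.+1) (cyc6 i.+2).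

Definition rhoB (v : 'M[F]_(4, 8)) (i j : nat) : F := rho v i - rho v j.

End Polylogarithms.

(* Main.v *)
(* The factors rho_i, rho_(i,j) and rho_(1,2) rho_(3,4) - rho_1 rho_(3,2) that
   occur in the symbols factor, by the Plucker relations, into brackets, into
   polynomials <abcg><defh> - <abch><defg>, and into one quartic P in brackets.
   So both symbols become combinations of words in these letters, with signs
   irrelevant since -1 is torsion. Under Alt_8 a word changes by the sign of a
   permutation when its labels are permuted. The columns of roles that the eight
   labels play in the four letters of a word can therefore be sorted, and a word
   with two equal columns vanishes; e.g. a word of four brackets survives only if
   the eight labels have distinct membership patterns. Only the symmetries of the
   letters under exchange of the two triples, respectively under
   (16)(25)(34)(78) for P, remain to be taken into account. After applying the
   projector Pi_sh, all words cancel. *)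

Require Import Defs.
From HB Require Import structures.
From mathcomp Require Import all_boot all_order all_fingroup all_algebra.
From mathcomp Require Import finmap fraction complex reals.
From mathcomp Require Import ring.
From mathcomp.multinomials Require Import mpoly.
From mathcomp.multinomials Require Import monalg.

Set Implicit Arguments.
Unset Strict Implicit.
Unset Printing Implicit Defensive.

Import GRing.Theory.
Local Open Scope ring_scope.

(** * The tensor algebra *)

Section LinExt.
Variables (K : choiceType) (V : lmodType rat) (f : K -> V).

(** Coefficients vanish off the support, so the index set may be enlarged; linearity is then checked
    on the union of two supports. *)
Lemma lin_extEw (d : {fset K}) (g : {malg rat[K]}) :
  fsubset (monalg.msupp g) d -> lin_ext f g = \sum_(k <- d) monalg.mcoeff k g *: f k.
Proof.
move=> sgd; rewrite lin_ext.unlock.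
by apply: big_fset_incl => // k _ /monalg.mcoeff_outdom ->; rewrite scale0r.
Qed.

Lemma lin_ext_is_linear : linear (lin_ext f).
Proof.
move=> c g h; pose d := fsetU (monalg.msupp g) (monalg.msupp h).
have sg : fsubset (monalg.msupp g) d by apply: fsubsetUl.
have sh : fsubset (monalg.msupp h) d by apply: fsubsetUr.
have sc : fsubset (monalg.msupp (c *: g + h)) d.
  apply: fsubset_trans (monalg.msuppD_le _ _) _.
  by rewrite fsetSU // monalg.msuppZ_le.
rewrite (lin_extEw sg) (lin_extEw sh) (lin_extEw sc) scaler_sumr -big_split /=.
by apply: eq_bigr => k _; rewrite monalg.mcoeffD monalg.mcoeffZ scalerDl scalerA.
Qed.
HB.instance Definition _ :=
  GRing.isLinear.Build rat ({malg rat[K]}) V *:%R (lin_ext f) lin_ext_is_linear.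

Lemma lin_extU k : lin_ext f (monalg.mkmalgU k 1) = f k.
Proof.
rewrite lin_ext.unlock monalg.msuppU oner_eq0 big_seq_fset1.
by rewrite monalg.mcoeffUU scale1r.
Qed.
End LinExt.

Section TensorEq.
Context {F : fieldType}.
Implicit Types (s t u : tensor F) (x y z a : nonzero F) (p q w : seq (nonzero F)).

Lemma tensor_nullZ c s : tensor_null s -> tensor_null (c *: s).
Proof. by move=> h; rewrite -[_ *: _]addr0; apply: tensor_null_lin h (tensor_null0 _). Qed.
Lemma tensor_nullD s t : tensor_null s -> tensor_null t -> tensor_null (s + t).
Proof. by move=> hs ht; rewrite -[s]scale1r; apply: tensor_null_lin. Qed.

Lemma teq_refl s : tensor_eq s s.
Proof. by rewrite /tensor_eq subrr; apply: tensor_null0. Qed.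
Lemma teq_sym s t : tensor_eq s t -> tensor_eq t s.
Proof. by move=> h; rewrite /tensor_eq -opprB -scaleN1r; apply: tensor_nullZ. Qed.
Lemma teq_trans s t u : tensor_eq s t -> tensor_eq t u -> tensor_eq s u.
Proof. by move=> h k; rewrite /tensor_eq -(subrKA t); apply: tensor_nullD. Qed.
Lemma teqD s s' t t' : tensor_eq s s' -> tensor_eq t t' -> tensor_eq (s + t) (s' + t').
Proof. by move=> h k; rewrite /tensor_eq opprD addrACA; apply: tensor_nullD. Qed.
Lemma teqZ c s t : tensor_eq s t -> tensor_eq (c *: s) (c *: t).
Proof. by move=> h; rewrite /tensor_eq -scalerBr; apply: tensor_nullZ. Qed.
Lemma teq_sum I (r : seq I) (P : pred I) (f g : I -> tensor F) :
  (forall i, P i -> tensor_eq (f i) (g i)) ->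
  tensor_eq (\sum_(i <- r | P i) f i) (\sum_(i <- r | P i) g i).
Proof.
by move=> h; elim/big_ind2: _ => //; [exact: teq_refl | move=> *; exact: teqD].
Qed.

Lemma teq_double0 s : tensor_eq s (- s) -> tensor_eq s 0.
Proof.
rewrite /tensor_eq opprK subr0 => /(tensor_nullZ (2^-1)).
by rewrite -mulr2n -scaler_nat scalerA mulVf // scale1r.
Qed.

Lemma word_mul p q x y z : val z = val x * val y ->
  tensor_eq (word (p ++ z :: q)) (word (p ++ x :: q) + word (p ++ y :: q)).
Proof. by move=> h; rewrite /tensor_eq opprD addrA; apply: tensor_null_mul. Qed.

(** From 1 = 1 * 1 the word equals its double, hence is null. From (-1) * (-1) = 1 twice the word is
    null, and 2 is invertible in [rat]. *)
Lemma word_root1 p q x : val x = 1 \/ val x = -1 -> tensor_eq (word (p ++ x :: q)) 0.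
Proof.
have one y : val y = 1 -> tensor_eq (word (p ++ y :: q)) 0.
  move=> y1; have := @word_mul p q y y y; rewrite y1 mulr1 => /(_ erefl).
  rewrite /tensor_eq opprD addNKr -scaleN1r subr0 => /(tensor_nullZ (-1)).
  by rewrite scalerA mulrNN mulr1 scale1r.
case=> [/one //|x1].
have n1 : (1 : F) != 0 by apply: oner_neq0.
have := @word_mul p q x x (Sub 1 n1); rewrite x1 mulrNN mulr1 SubK => /(_ erefl) h.
have {}h := teq_trans (teq_sym h) (one _ (SubK _ _)).
apply: teq_double0; rewrite /tensor_eq opprK.
by move: h; rewrite /tensor_eq subr0.
Qed.

Lemma word_sign p q x y : val x = val y \/ val x = - val y ->
  tensor_eq (word (p ++ x :: q)) (word (p ++ y :: q)).
Proof.
case=> [/val_inj -> | h]; first exact: teq_refl.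
have n1 : (-1 : F) != 0 by rewrite oppr_eq0 oner_neq0.
apply: teq_trans (_ : tensor_eq _ (word (p ++ Sub (-1) n1 :: q) + word (p ++ y :: q))) _.
  by apply: word_mul; rewrite SubK mulN1r.
rewrite -[X in tensor_eq _ X]add0r; apply: teqD (teq_refl _).
by apply: word_root1; right; rewrite SubK.
Qed.

(** The prefix [p] collects the entries already replaced, so that the induction changes one entry at
    a time. *)
Lemma word_signs I (f g : I -> nonzero F) p (w : seq I) :
  (forall i, val (f i) = val (g i) \/ val (f i) = - val (g i)) ->
  tensor_eq (word (p ++ map f w)) (word (p ++ map g w)).
Proof.
move=> fg; elim: w p => [|i w IH] p /=; first exact: teq_refl.
apply: teq_trans (word_sign p (map f w) (fg i)) _.
by rewrite -!cat_rcons; apply: IH.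
Qed.

Lemma tensor_rcons_word w a : tensor_rcons (word w) a = word (rcons w a).
Proof. exact: lin_extU. Qed.
Lemma tensor_rconsB s t a : tensor_rcons (s - t) a = tensor_rcons s a - tensor_rcons t a.
Proof. exact: linearB. Qed.
Lemma tensor_rcons_sum I (r : seq I) (c : I -> rat) (f : I -> tensor F) a :
  tensor_rcons (\sum_(i <- r) c i *: f i) a = \sum_(i <- r) c i *: tensor_rcons (f i) a.
Proof. by rewrite /tensor_rcons linear_sum; apply: eq_bigr => i _; rewrite linearZ. Qed.

Lemma tensor_null_rcons s a : tensor_null s -> tensor_null (tensor_rcons s a).
Proof.
elim=> [|c t u _ IHt _ IHu|p q x y z h].
- by rewrite /tensor_rcons linear0; apply: tensor_null0.
- by rewrite /tensor_rcons linearP; apply: tensor_null_lin.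
- by rewrite !tensor_rconsB !tensor_rcons_word !rcons_cat; apply: tensor_null_mul.
Qed.
Lemma teq_rcons s t a : tensor_eq s t -> tensor_eq (tensor_rcons s a) (tensor_rcons t a).
Proof. by rewrite /tensor_eq -tensor_rconsB; apply: tensor_null_rcons. Qed.

Lemma tensor_rcons_mul t x y z : val z = val x * val y ->
  tensor_eq (tensor_rcons t z) (tensor_rcons t x + tensor_rcons t y).
Proof.
move=> h; rewrite /tensor_rcons lin_ext.unlock -big_split /=.
apply: teq_sum => w _; rewrite -scalerDr -!cats1; apply: teqZ.
exact: word_mul.
Qed.

(** Naming both ends of the word replaces [belast] and [last], and lets [Pi_rec_mul] distinguish
    whether the changed entry is first, last or inside. *)
Lemma Pi_rec_rcons N a w b :
  Pi_rec N.+1 (a :: rcons w b) =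
  tensor_rcons (Pi_rec N (a :: w)) b - tensor_rcons (Pi_rec N (rcons w b)) a.
Proof. by case: w => [|c w] //=; rewrite belast_rcons last_rcons. Qed.

(** In each of the two terms the changed entry either stays in the recursive call, where induction
    applies, or is appended at the end, where [tensor_rcons_mul] applies. *)
Lemma Pi_rec_mul N p q x y z : val z = val x * val y ->
  tensor_eq (Pi_rec N (p ++ z :: q)) (Pi_rec N (p ++ x :: q) + Pi_rec N (p ++ y :: q)).
Proof.
move=> h; elim: N p q => [|N IH] p q; first exact: word_mul.
have sub s s' t t' u u' : tensor_eq s (t + u) -> tensor_eq s' (t' + u') ->
    tensor_eq (s - s') (t - t' + (u - u')).
  move=> hs hs'; rewrite addrACA -opprD; apply: teqD => //.
  by rewrite -!scaleN1r; apply: teqZ.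
have rcD t u a : tensor_rcons (t + u) a = tensor_rcons t a + tensor_rcons u a.
  exact: linearD.
case: p => [|a p]; case/lastP: q => [|q b].
- exact: (@word_mul [::] [::]).
- rewrite !cat0s !Pi_rec_rcons; apply: sub; last exact: tensor_rcons_mul.
  by rewrite -rcD; apply: teq_rcons; apply: (IH [::]).
- rewrite !cats1 !rcons_cons !Pi_rec_rcons; apply: sub; first exact: tensor_rcons_mul.
  by rewrite -rcD; apply: teq_rcons; rewrite -!cats1; apply: IH.
- rewrite !cat_cons -!rcons_cons -!rcons_cat !Pi_rec_rcons; apply: sub.
    by rewrite -rcD; apply: teq_rcons; apply: (IH (a :: p)).
  by rewrite -rcD; apply: teq_rcons; rewrite !rcons_cat; apply: IH.
Qed.

Lemma Pi_shP c s t : Pi_sh (c *: s + t) = c *: Pi_sh s + Pi_sh t.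
Proof. exact: linearP. Qed.
Lemma Pi_shB s t : Pi_sh (s - t) = Pi_sh s - Pi_sh t.
Proof. exact: linearB. Qed.
Lemma Pi_sh_sum I (r : seq I) (c : I -> rat) (f : I -> tensor F) :
  Pi_sh (\sum_(i <- r) c i *: f i) = \sum_(i <- r) c i *: Pi_sh (f i).
Proof. by rewrite /Pi_sh linear_sum; apply: eq_bigr => i _; rewrite linearZ. Qed.
Lemma Pi_sh_word w : Pi_sh (word w) = Pi_rec (size w) w.
Proof. exact: lin_extU. Qed.

(** The three words of a relation have equal length, so [Pi_rec] runs on them with equal fuel and
    [Pi_rec_mul] applies. *)
Lemma teq_Pi_sh s t : tensor_eq s t -> tensor_eq (Pi_sh s) (Pi_sh t).
Proof.
rewrite {2}/tensor_eq -Pi_shB /tensor_eq.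
elim=> [|c {}s {}t _ IHs _ IHt|p q x y z h].
- by rewrite /Pi_sh linear0; apply: tensor_null0.
- by rewrite Pi_shP; apply: tensor_null_lin.
- rewrite !Pi_shB !Pi_sh_word !size_cat /= -addrA -opprD.
  exact: Pi_rec_mul.
Qed.

End TensorEq.

(** * Formal words and their normal forms *)

(** A bare enumeration, instead of an ordinal type, keeps the computation in
    [formal_difference_vanishes] light. *)
Inductive pt := p1 | p2 | p3 | p4 | p5 | p6 | p7 | p8.

Definition lab (x : pt) : nat :=
  match x with
  | p1 => 1 | p2 => 2 | p3 => 3 | p4 => 4 | p5 => 5 | p6 => 6 | p7 => 7 | p8 => 8
  end.

Definition eqp (x y : pt) : bool :=
  match x, y with
  | p1, p1 | p2, p2 | p3, p3 | p4, p4 | p5, p5 | p6, p6 | p7, p7 | p8, p8 => true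
  | _, _ => false
  end.

Definition gtp (x y : pt) : bool := if (lab x - lab y)%N is 0%N then false else true.

Definition swap (i j x : pt) : pt := if eqp x i then j else if eqp x j then i else x.

(* [Lb a b c d] is <abcd>, [Lt a b c d e f g h] is <abcg><defh> - <abch><defg>,
   and [Lp a b c d e f g h] is the numerator of
   rho_(1,2) rho_(3,4) - rho_1 rho_(3,2) with 1, ..., 8 replaced by a, ..., h. *)
Inductive letter :=
| Lb of pt & pt & pt & pt
| Lt of pt & pt & pt & pt & pt & pt & pt & pt
| Lp of pt & pt & pt & pt & pt & pt & pt & pt.

Definition labels (l : letter) : seq pt :=
  match l with
  | Lb a b c d => [:: a; b; c; d]
  | Lt a b c d e f g h | Lp a b c d e f g h => [:: a; b; c; d; e; f; g; h]
  end.

Definition eql (l m : letter) : bool :=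
  match l, m with
  | Lb a b c d, Lb a' b' c' d' => [&& eqp a a', eqp b b', eqp c c' & eqp d d']
  | Lt a b c d e f g h, Lt a' b' c' d' e' f' g' h'
  | Lp a b c d e f g h, Lp a' b' c' d' e' f' g' h' =>
      [&& eqp a a', eqp b b', eqp c c', eqp d d', eqp e e', eqp f f', eqp g g' & eqp h h']
  | _, _ => false
  end.

Fixpoint eqs {K} (e : K -> K -> bool) (s t : seq K) : bool :=
  match s, t with
  | [::], [::] => true
  | a :: s', b :: t' => e a b && eqs e s' t'
  | _, _ => false
  end.

Definition relabel (s : pt -> pt) (l : letter) : letter :=
  match l with
  | Lb a b c d => Lb (s a) (s b) (s c) (s d)
  | Lt a b c d e f g h => Lt (s a) (s b) (s c) (s d) (s e) (s f) (s g) (s h)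
  | Lp a b c d e f g h => Lp (s a) (s b) (s c) (s d) (s e) (s f) (s g) (s h)
  end.

(** In continuation-passing style each comparison applies at most one transposition, so [evl_norml]
    needs only the effect of transpositions on a letter. *)
Definition sort2 {K} (a b : pt) (k : pt -> pt -> K) : K :=
  if gtp a b then k b a else k a b.

Definition sort3 {K} (a b c : pt) (k : pt -> pt -> pt -> K) : K :=
  sort2 a b (fun a b => sort2 b c (fun b c => sort2 a b (fun a b => k a b c))).

(** For a bracket, the first pass puts the largest of three labels third, and the next comparison
    puts the largest of all last. Exchanging the triples of [Lt] and reversing [Lp] are left to
    [variants_l]. *)
Definition norml (l : letter) : letter :=
  match l with
  | Lb a b c d =>
      sort3 a b c (fun a b c => sort2 c d (fun c d => sort3 a b c (fun a b c =>
        Lb a b c d)))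
  | Lt a b c d e f g h =>
      sort3 a b c (fun a b c => sort3 d e f (fun d e f => sort2 g h (fun g h =>
        Lt a b c d e f g h)))
  | Lp _ _ _ _ _ _ _ _ => l
  end.

(** * Canonical forms of words under relabelling *)

Definition normw := map norml.

Definition variants_l (l : letter) : seq letter :=
  match l with
  | Lb _ _ _ _ => [:: l]
  | Lt a b c d e f g h => [:: l; Lt d e f a b c g h]
  | Lp a b c d e f g h => [:: l; Lp f e d c b a h g]
  end.

Fixpoint variants (w : seq letter) : seq (seq letter) :=
  if w is l :: w' then
    let ws := variants w' in
    flatten [seq [seq m :: u | u <- ws] | m <- variants_l l]
  else [:: [::]].

(* Interchanging two labels with the same role in a letter preserves the letter
   up to sign; for [Lp], whose labels have distinct roles, nothing is claimed. *)
Definition role (x : pt) (l : letter) : nat :=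
  match l with
  | Lb a b c d => if [|| eqp x a, eqp x b, eqp x c | eqp x d] then 1 else 0
  | Lt a b c d e f g h =>
      if eqp x g || eqp x h then 4 else
      if [|| eqp x a, eqp x b | eqp x c] then
        if [|| eqp x d, eqp x e | eqp x f] then 3 else 1
      else if [|| eqp x d, eqp x e | eqp x f] then 2 else 0
  | Lp a b c d e f g h => find (eqp x) (labels l)
  end.

Fixpoint lexlt (s t : seq nat) : bool :=
  match s, t with
  | a :: s', b :: t' =>
      match (a - b)%N, (b - a)%N with
      | 0%N, 0%N => lexlt s' t'
      | 0%N, _ => true
      | _, _ => false
      end
  | [::], _ :: _ => true
  | _, _ => false
  end.

Definition keys (w : seq letter) : seq (pt * seq nat) :=
  [seq (x, map (role x) w) | x <- [:: p1; p2; p3; p4; p5; p6; p7; p8]].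

Fixpoint dup (ks : seq (pt * seq nat)) : option (pt * pt) :=
  if ks is (x, k) :: t then
    (fix scan u :=
       if u is (y, k') :: u' then if eqs eqn k k' then Some (x, y) else scan u'
       else dup t) t
  else None.

Fixpoint argmin (x : pt) k (ks : seq (pt * seq nat)) : pt :=
  if ks is (y, k') :: t then if lexlt k' k then argmin y k' t else argmin x k t else x.

(** Selection sort of the labels by key: after the transposition [x] carries the least key and [y]
    inherits that of [x]. *)
Fixpoint swaps (n : nat) (ks : seq (pt * seq nat)) : seq (pt * pt) :=
  match n, ks with
  | n'.+1, (x, k) :: t =>
    let y := argmin x k t in
    if eqp x y then swaps n' t
    else (x, y) :: swaps n' [seq (z.1, if eqp z.1 y then k else z.2) | z <- t]
  | _, _ => [::]
  end.

Definition swapw (w : seq letter) (ij : pt * pt) : seq letter :=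
  map (relabel (swap ij.1 ij.2)) w.

(* [(b, w)] stands for (-1)^b times the word w, and [None] for 0. *)
Definition signed_word := (bool * seq letter)%type.

(** A repeated key suggests that the word is its own negative. This is tested after the swap instead
    of being deduced from [role], and the word is kept if the test fails. With distinct keys the
    sorting permutation contributes its sign. *)
Definition canon1 (w : seq letter) : option signed_word :=
  let ks := keys w in
  if dup ks is Some ij then
    if ~~ eqp ij.1 ij.2 && eqs eql (normw (swapw w ij)) w then None else Some (false, w)
  else
    let sw := swaps 8 ks in Some (odd (size sw), normw (foldl swapw w sw)).

Definition code (w : seq letter) : seq nat :=
  flatten [seq size (labels l) :: map lab (labels l) | l <- w].

Definition ltw (w w' : seq letter) : bool := lexlt (code w) (code w').

(* If two variants of a word give the same word with opposite signs, it vanishes. *)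
Fixpoint best (x : signed_word) (rs : seq (option signed_word)) : option signed_word :=
  match rs with
  | [::] => Some x
  | None :: _ => None
  | Some y :: rs' =>
      if eqs eql x.2 y.2 then if x.1 (+) y.1 then None else best x rs'
      else best (if ltw y.2 x.2 then y else x) rs'
  end.

Definition canon (w : seq letter) : option signed_word :=
  let rs := [seq canon1 (normw u) | u <- variants w] in
  match rs with
  | [::] => Some (false, w)
  | None :: _ => None
  | Some x :: rs' => best x rs'
  end.

(** * Integer formal sums *)

Definition fs (K : Type) := seq (int * K).
Definition fscale {K} (c : int) (s : fs K) : fs K := [seq (c * x.1, x.2) | x <- s].

Fixpoint merge_fs {K} (e : K -> K -> bool) (s : fs K) : fs K :=
  if s is (c, w) :: s' then
    if merge_fs e s' is (c', w') :: r then
      if e w w' then if c + c' == 0 then r else (c + c', w) :: r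
      else (c, w) :: (c', w') :: r
    else [:: (c, w)]
  else [::].

Definition collect {K} (e : K -> K -> bool) (code : K -> seq nat) (s : fs K) : fs K :=
  merge_fs e (map snd (sort (fun x y => ~~ lexlt y.1 x.1) [seq (code x.2, x) | x <- s])).

Fixpoint canon_fs (s : fs (seq letter)) : fs (seq letter) :=
  if s is (c, w) :: s' then
    if canon w is Some (b, w') then ((if b then - c else c), w') :: canon_fs s'
    else canon_fs s'
  else [::].

Definition nf s := collect (eqs eql) code (canon_fs s).

Fixpoint fPi {K} (N : nat) (w : seq K) : fs (seq K) :=
  match N, w with
  | N'.+1, a :: ((_ :: _) as s) =>
      [seq (x.1, rcons x.2 (last a s)) | x <- fPi N' (belast a s)]
      ++ [seq (- x.1, rcons x.2 a) | x <- fPi N' s]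
  | _, _ => [:: (1, w)]
  end.

Definition fPi_fs {K} (s : fs (seq K)) : fs (seq K) :=
  flatten [seq fscale x.1 (fPi (size x.2) x.2) | x <- s].

(* The possible entries 0, 1, x, y of an iterated integral; a pair of them stands for
   their difference. *)
Inductive point := PO | PI | PX | PY.

Fixpoint fsymb (N : nat) (a0 : point) (s : seq point) (a1 : point) :
    fs (seq (point * point)) :=
  if N is N'.+1 then
    let a i := nth PO (a0 :: rcons s a1) i in
    flatten [seq
      let t := fsymb N' a0 (take i s ++ drop i.+1 s) a1 in
      [seq (x.1, rcons x.2 (a i.+2, a i.+1)) | x <- t]
      ++ [seq (- x.1, rcons x.2 (a i, a i.+1)) | x <- t] | i <- iota 0 N]
  else [:: (1, [::])].

(* [(e, l)] in a factorisation is the factor l^e. *)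
Definition fact := fs letter.

Fixpoint expand (w : seq fact) : fs (seq letter) :=
  if w is f :: w' then let r := expand w' in
    flatten [seq [seq (c.1 * d.1, c.2 :: d.2) | d <- r] | c <- f]
  else [:: (1, [::])].

(* Normalising each expansion separately keeps the recursions in [vm_compute] shallow. *)
Definition expand_fs (d : point * point -> fact) (s : fs (seq (point * point))) :
    fs (seq letter) :=
  flatten [seq nf (fscale x.1 (expand (map d x.2))) | x <- s].

(** * Factorisations of the arguments into letters *)

Definition fN (f : fact) : fact := fscale (-1) f.

Definition quo (s t : seq letter) : fact := [seq (1, l) | l <- s] ++ [seq (-1, l) | l <- t].

Definition simp (f : fact) : fact := collect eql (fun l => code [:: l]) f.

(* rho_i = n_i / d_i *)
Definition n1 := Lb p1 p2 p3 p7. Definition d1 := Lb p1 p2 p3 p8.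
Definition n2 := Lb p2 p3 p4 p7. Definition d2 := Lb p2 p3 p4 p8.
Definition n3 := Lb p3 p4 p5 p7. Definition d3 := Lb p3 p4 p5 p8.
Definition n4 := Lb p4 p5 p6 p7. Definition d4 := Lb p4 p5 p6 p8.
Definition r1 := quo [:: n1] [:: d1].
Definition r2 := quo [:: n2] [:: d2].
Definition r4 := quo [:: n4] [:: d4].
(** When two triples share two vectors, a three-term Plücker relation splits the numerator of the
    difference into two brackets. The other differences need a letter [Lt]. *)
Definition r12 := quo [:: Lb p1 p2 p3 p4; Lb p2 p3 p7 p8] [:: d1; d2].
Definition r32 := quo [:: Lb p2 p3 p4 p5; Lb p3 p4 p7 p8] [:: d2; d3].
Definition r34 := quo [:: Lb p3 p4 p5 p6; Lb p4 p5 p7 p8] [:: d3; d4].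
Definition r13 := quo [:: Lt p1 p2 p3 p3 p4 p5 p7 p8] [:: d1; d3].
Definition r24 := quo [:: Lt p2 p3 p4 p4 p5 p6 p7 p8] [:: d2; d4].
Definition r14 := quo [:: Lt p1 p2 p3 p4 p5 p6 p7 p8] [:: d1; d4].
Definition rP := quo [:: Lp p1 p2 p3 p4 p5 p6 p7 p8] [:: d1; d2; d3; d4].

(* Arguments: the factorisations of x, y, 1 - x, 1 - y and x - y. *)
Definition table (x y x' y' xy : fact) (ij : point * point) : fact :=
  match ij with
  | (PO, PX) | (PX, PO) => x | (PO, PY) | (PY, PO) => y
  | (PI, PX) | (PX, PI) => x' | (PI, PY) | (PY, PI) => y'
  | (PX, PY) | (PY, PX) => xy | _ => [::]
  end.

(** The differences x - y of both integrals and 1 - z for the argument z of [Li4] have the common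
    numerator rho_(1,2) rho_(3,4) - rho_1 rho_(3,2), factored in [rP]. *)
Definition tab1 := table (simp (r12 ++ r34 ++ fN (r32 ++ r14))) (simp (r1 ++ fN r14))
  (simp (r13 ++ r24 ++ fN (r32 ++ r14))) (simp (r4 ++ fN r14)) (simp (rP ++ fN (r32 ++ r14))).

Definition tab2 := table (simp (r12 ++ fN r1)) (simp (r32 ++ fN r34)) (simp (r2 ++ fN r1))
  (simp (r24 ++ fN r34)) (simp (rP ++ fN (r1 ++ r34))).

(* Li_4 has the entries 0, 1, z; the unused fourth entry is set to 0. *)
Definition tab3 :=
  let z := simp (r1 ++ r32 ++ fN (r12 ++ r34)) in
  table z [::] (simp (rP ++ fN (r12 ++ r34))) [::] z.

Definition I31_word := fsymb 4 PO [:: PX; PO; PO; PY] PI.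

Definition Li4_word := fsymb 4 PO [:: PI; PO; PO; PO] PX.
Definition Gr4_word := [:: Lb p1 p2 p3 p4; Lb p2 p3 p4 p5; Lb p3 p4 p5 p6; Lb p4 p5 p6 p7].

(** 56 is 7/144 times the normalising factor 2 (4!)^2 = 1152 of [symbol_Gr4]. The last coefficient
    is +6, since [Li4] is minus an iterated integral and its term is subtracted. *)
Definition formal_difference : fs (seq letter) :=
  (56, Gr4_word)
  :: fscale (-1) (expand_fs tab1 I31_word)
  ++ fscale (-2) (expand_fs tab2 I31_word)
  ++ fscale 6 (expand_fs tab3 Li4_word).

Definition vanishes {K} (s : fs K) : bool := if s is [::] then true else false.

(** The finite check to which the theorem is reduced. Terms are collected before [fPi_fs], because
    the projector turns each word of four letters into eight. *)
Lemma formal_difference_vanishes : vanishes (nf (fPi_fs (nf formal_difference))).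
Proof. by vm_compute. Qed.

(** * Brackets and letters *)

Section Bracket.
Context {R : comNzRingType}.
Implicit Type v : 'M[R]_(4, 8).

(** Any commutative ring is allowed, so that brackets can be transported between integers,
    polynomials and rational functions. *)
Definition br v (a b c d : pt) : R :=
  \det (\matrix_(i < 4, j < 4) v i (inord (nth 0%N [:: lab a; lab b; lab c; lab d] j).-1)).

Definition ix (a : pt) : 'I_8 := inord (lab a).-1.

Lemma ixE a : ix a = (lab a).-1 :> nat.
Proof. by rewrite inordK //; case: a. Qed.

Definition minor2 v (i j : 'I_4) (a b : pt) : R :=
  v i (ix a) * v j (ix b) - v i (ix b) * v j (ix a).

(** Laplace expansion along the first two rows. It turns the sign rules and Plücker relations into
    polynomial identities for [ring]. *)
Lemma brE v a b c d :
  let i : 'I_4 := ord0 in let j : 'I_4 := lift ord0 ord0 in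
  let k : 'I_4 := lift ord0 (lift ord0 ord0) in
  let l : 'I_4 := lift ord0 (lift ord0 (lift ord0 ord0)) in
  br v a b c d =
    minor2 v i j a b * minor2 v k l c d - minor2 v i j a c * minor2 v k l b d
    + minor2 v i j a d * minor2 v k l b c + minor2 v i j b c * minor2 v k l a d
    - minor2 v i j b d * minor2 v k l a c + minor2 v i j c d * minor2 v k l a b.
Proof.
move=> i j k l; rewrite /br (expand_det_row _ ord0) !big_ord_recl big_ord0 /cofactor.
rewrite !(expand_det_row _ (ord0 : 'I_3)) !big_ord_recl !big_ord0 /cofactor.
rewrite !(expand_det_row _ (ord0 : 'I_2)) !big_ord_recl !big_ord0 /cofactor !det_mx11.
rewrite !mxE /= -!/(ix _) /minor2 -/i -/j -/k -/l.
rewrite !exprD.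
ring.
Qed.
End Bracket.

Section Letters.
Context {R : comNzRingType}.
Implicit Type v : 'M[R]_(4, 8).

Definition evl_br (B : pt -> pt -> pt -> pt -> R) (l : letter) : R :=
  match l with
  | Lb a b c d => B a b c d
  | Lt a b c d e f g h => B a b c g * B d e f h - B a b c h * B d e f g
  | Lp a b c d e f g h =>
      let n1 := B a b c g in let n2 := B b c d g in
      let n3 := B c d e g in let n4 := B d e f g in
      let d1 := B a b c h in let d2 := B b c d h in
      let d3 := B c d e h in let d4 := B d e f h in
      n1 * n2 * d3 * d4 - n1 * d2 * d3 * n4 + d1 * n2 * d3 * n4 - d1 * n2 * n3 * d4
  end.

Definition evl v := evl_br (br v).

Lemma brC12 v a b c d : br v b a c d = - br v a b c d.
Proof. by rewrite !brE /minor2; ring. Qed.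
Lemma brC23 v a b c d : br v a c b d = - br v a b c d.
Proof. by rewrite !brE /minor2; ring. Qed.
Lemma brC34 v a b c d : br v a b d c = - br v a b c d.
Proof. by rewrite !brE /minor2; ring. Qed.

(* With two fixed vectors the brackets are the values of a decomposable 2-form. *)
Lemma br_plucker v a b c d e f :
  br v a b c d * br v a b e f - br v a b c e * br v a b d f + br v a b c f * br v a b d e = 0.
Proof. by rewrite !brE /minor2; ring. Qed.
End Letters.

Lemma br_map (R S : comNzRingType) (f : {rmorphism R -> S}) (v : 'M[R]_(4, 8)) a b c d :
  br (map_mx f v) a b c d = f (br v a b c d).
Proof. by rewrite /br -det_map_mx; congr (\det _); apply/matrixP => i j; rewrite !mxE. Qed.

Lemma evl_map (R S : comNzRingType) (f : {rmorphism R -> S}) (v : 'M[R]_(4, 8)) l :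
  evl (map_mx f v) l = f (evl v l).
Proof. by case: l => * /=; rewrite !br_map ?(rmorphB, rmorphD, rmorphM). Qed.

Lemma eqpP x y : reflect (x = y) (eqp x y).
Proof. by apply: (iffP idP); case: x; case: y. Qed.

Lemma ix_inj : injective ix.
Proof. by move=> a b /(congr1 val); rewrite /= !ixE; case: a; case: b. Qed.

Lemma ix_swap i j x : ix (swap i j x) = tperm (ix i) (ix j) (ix x).
Proof.
rewrite /swap; case: eqpP => [->|xi]; first by rewrite tpermL.
by case: eqpP => [->|xj]; rewrite ?tpermR // tpermD //; apply/eqP=> /ix_inj /esym.
Qed.

Lemma br_swap (R : comNzRingType) (v : 'M[R]_(4, 8)) i j a b c d :
  br v (swap i j a) (swap i j b) (swap i j c) (swap i j d) =
  br (col_perm (tperm (ix i) (ix j)) v) a b c d.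
Proof.
congr (\det _); apply/matrixP => k m; rewrite !mxE; congr (v k _).
by case: m => [[|[|[|[|//]]]]] ? /=; rewrite -!/(ix _) ix_swap.
Qed.

Lemma evl_swap (R : comNzRingType) (v : 'M[R]_(4, 8)) i j l :
  evl v (relabel (swap i j) l) = evl (col_perm (tperm (ix i) (ix j)) v) l.
Proof. by case: l => * /=; rewrite !br_swap. Qed.

(* Letters matter only up to sign, -1 being torsion. *)
Definition pm {R : comNzRingType} (x y : R) := x = y \/ x = - y.

Section Signs.
Context {R : comNzRingType}.
Implicit Types (x y z : R) (v : 'M[R]_(4, 8)).

Lemma pmN x y : pm (- x) y <-> pm x y.
Proof.
split=> -[h|h]; first by right; rewrite -h opprK.
- by left; apply: oppr_inj.
- by right; rewrite h.
- by left; rewrite h opprK.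
Qed.

(** Proof rules for the continuations: a property stable under transpositions survives sorting,
    whichever branches the comparisons take. *)
Lemma sort2P K (P : pt -> pt -> Prop) (Q : K -> Prop) a b k :
  (P a b -> P b a) -> (forall a b, P a b -> Q (k a b)) -> P a b -> Q (sort2 a b k).
Proof. by rewrite /sort2 => Pab Pk p; case: ifP => _; apply: Pk; auto. Qed.

Lemma sort3P K (P : pt -> pt -> pt -> Prop) (Q : K -> Prop) a b c k :
  (forall a b c, P a b c -> P b a c) -> (forall a b c, P a b c -> P a c b) ->
  (forall a b c, P a b c -> Q (k a b c)) -> P a b c -> Q (sort3 a b c k).
Proof.
move=> P12 P23 Pk; rewrite /sort3.
apply: (sort2P (P := fun a b => P a b c)) (P12 _ _ _) _ => {}a {}b.
apply: (sort2P (P := fun b c => P a b c)) (P23 _ _ _) _ => {}b {}c.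
by apply: (sort2P (P := fun a b => P a b c)) (P12 _ _ _) _ => *; apply: Pk.
Qed.

Lemma evl_norml v l : pm (evl v (norml l)) (evl v l).
Proof.
case: l => [a b c d|a b c d e f g h|*]; last by left.
(* Abstracting the reference value [z] leaves the labels free to be permuted. *)
- set z := evl v (Lb a b c d); have hz : pm (br v a b c d) z by left.
  clearbody z.
  pose Q l := pm (evl v l) z; rewrite -/(Q _) /norml.
  have s12 a' b' c' d' : pm (br v a' b' c' d') z -> pm (br v b' a' c' d') z
    by rewrite brC12 pmN.
  have s23 a' b' c' d' : pm (br v a' b' c' d') z -> pm (br v a' c' b' d') z
    by rewrite brC23 pmN.
  have s34 a' b' c' d' : pm (br v a' b' c' d') z -> pm (br v a' b' d' c') z
    by rewrite brC34 pmN.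
  refine (sort3P (P := fun a b c => pm (br v a b c d) z) (Q := Q)
    (fun a b c => s12 a b c d) (fun a b c => s23 a b c d) _ hz) => {hz}a {}b {}c hz.
  refine (sort2P (P := fun c d => pm (br v a b c d) z) (Q := Q) _ _ hz) => [|{hz}c {}d hz].
    exact: s34.
  by refine (sort3P (P := fun a b c => pm (br v a b c d) z) (Q := Q)
    (fun a b c => s12 a b c d) (fun a b c => s23 a b c d) _ hz).
- pose T a b c d e f g h := evl v (Lt a b c d e f g h).
  set z := evl v (Lt a b c d e f g h); have hz : pm (T a b c d e f g h) z by left.
  clearbody z.
  have neg x y : y = - x -> pm x z -> pm y z by move=> -> ?; apply/pmN.
  pose Q l := pm (evl v l) z; rewrite -/(Q _) /norml.
  refine (sort3P (P := fun a b c => pm (T a b c d e f g h) z) (Q := Q) _ _ _ hz)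
    => {hz}a {}b {}c.
  + by apply: neg; rewrite /T /= !(brC12 _ a b); ring.
  + by apply: neg; rewrite /T /= !(brC23 _ a b c); ring.
  move=> hz.
  refine (sort3P (P := fun d e f => pm (T a b c d e f g h) z) (Q := Q) _ _ _ hz)
    => {hz}d {}e {}f.
  + by apply: neg; rewrite /T /= !(brC12 _ d e); ring.
  + by apply: neg; rewrite /T /= !(brC23 _ d e f); ring.
  move=> hz.
  refine (sort2P (P := fun g h => pm (T a b c d e f g h) z) (Q := Q) _ _ hz) => //.
  by apply: neg; rewrite /T /=; ring.
Qed.

Lemma evl_variants v l m : List.In m (variants_l l) -> pm (evl v m) (evl v l).
Proof.
case: l => [a b c d|a b c d e f g h|a b c d e f g h] /=.
- by case=> // <-; left.
- by case=> [<-|[<-|//]]; [left | right => /=; ring].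
case=> [<-|[<-|//]]; left=> //=.
(* Up to sign, reversal exchanges [n1] with [d4], [n2] with [d3], [n3] with [d2] and [n4] with [d1].
   Each monomial has four brackets, so the signs cancel. *)
have C (i j k x : pt) : br v i j k x = - br v k j i x.
  by rewrite !brE /minor2; ring.
by rewrite !(C f e d) !(C e d c) !(C d c b) !(C c b a); ring.
Qed.
End Signs.

(** * Nonvanishing of the letters on the generic configuration *)

Section Generic.
Variable R : realType.

(** The letters into which the arguments factor, in the order in which [good] is destructured
    later. *)
Definition entry_letters : seq letter :=
  [:: n1; n2; n3; n4; d1; d2; d3; d4; Lb p1 p2 p3 p4; Lb p2 p3 p7 p8; Lb p2 p3 p4 p5;
      Lb p3 p4 p7 p8; Lb p3 p4 p5 p6; Lb p4 p5 p7 p8; Lt p1 p2 p3 p3 p4 p5 p7 p8;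
      Lt p2 p3 p4 p4 p5 p6 p7 p8; Lt p1 p2 p3 p4 p5 p6 p7 p8; Lp p1 p2 p3 p4 p5 p6 p7 p8].

Definition good (F : fieldType) (v : 'M[F]_(4, 8)) :=
  all (fun l => evl v l != 0) entry_letters.

(** A small integer configuration at which no entry letter vanishes, as [witness_good] confirms by
    evaluation. *)
Definition witness_entry (i j : nat) : int := nth 0 (nth [::]
    [:: [:: 0; 1; 0; 1; 1; 0; 0; 0]; [:: 0; -1; 1; 1; 0; -1; 0; 0];
        [:: 0; 0; -1; 1; 0; 0; 1; 1]; [:: 1; 0; 0; 1; 0; 0; 0; -1]] i) j.

Definition witness : 'M[int]_(4, 8) := \matrix_(i < 4, j < 8) witness_entry i j.

Definition witness_minor2 (i j : nat) (a b : pt) : int :=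
  witness_entry i (lab a).-1 * witness_entry j (lab b).-1
  - witness_entry i (lab b).-1 * witness_entry j (lab a).-1.

(** The expansion of [brE] written out on integers, so that nonvanishing is decided by
    evaluation. *)
Definition witness_br (a b c d : pt) : int :=
  let m := witness_minor2 0 1 in let n := witness_minor2 2 3 in
  m a b * n c d - m a c * n b d + m a d * n b c
  + m b c * n a d - m b d * n a c + m c d * n a b.

Lemma witness_brE a b c d : br witness a b c d = witness_br a b c d.
Proof. by rewrite brE /minor2 !mxE !ixE. Qed.

Lemma witness_good : all (fun l => evl witness l != 0) entry_letters.
Proof.
have E l : evl witness l = evl_br witness_br l by case: l => * /=; rewrite !witness_brE.
by rewrite (eq_all (a2 := fun l => evl_br witness_br l != 0)) // => l; rewrite E.
Qed.

(** Each letter is a polynomial in the coordinates, hence nonzero in the fraction field as soon as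
    one specialisation is nonzero. *)
Lemma good_generic (s : 'S_8) : good (col_perm s (generic_config R)).
Proof.
pose X := \matrix_(a < 4, k < 8) mpolyX R[i] (mnm1 (mxvec_index a k)).
have -> : generic_config R = map_mx (@tofrac _) X by apply/matrixP => a k; rewrite !mxE.
apply: sub_all witness_good => l; rewrite -map_col_perm evl_map tofrac_eq0.
(* Permuting the witness by the inverse of [s] first makes the column permutation [s] return the
   witness itself. *)
apply: contraNneq => Xl0; pose M := col_perm s^-1 (map_mx (intr : int -> R[i]) witness).
pose u k := mxvec M 0 k.
have XM : map_mx (meval u) X = M.
  by apply/matrixP => a k; rewrite !mxE mevalXU /u mxvecE !mxE.
have := evl_map (meval u) (col_perm s X) l; rewrite Xl0 rmorph0 map_col_perm XM.
rewrite -col_permM mulgV col_perm1 (evl_map (intr : int -> R[i])) => /eqP.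
by rewrite intr_eq0.
Qed.
End Generic.

(** * Soundness of the formal computation *)

Section Den.
Context {V : lmodType rat}.

Definition den {K} (g : K -> V) (s : fs K) : V := \sum_(x <- s) x.1%:~R *: g x.2.

Lemma den_cat K (g : K -> V) s t : den g (s ++ t) = den g s + den g t.
Proof. exact: big_cat. Qed.

Lemma den_cons K (g : K -> V) x s : den g (x :: s) = x.1%:~R *: g x.2 + den g s.
Proof. exact: big_cons. Qed.

Lemma den_scale K (g : K -> V) c s : den g (fscale c s) = c%:~R *: den g s.
Proof.
rewrite /den big_map scaler_sumr; apply: eq_bigr => x _.
by rewrite /= intrM scalerA.
Qed.

Lemma den_flatten K (g : K -> V) ss : den g (flatten ss) = \sum_(s <- ss) den g s.
Proof.
by elim: ss => [|s ss IH]; rewrite ?big_nil ?big_cons /= ?den_cat ?IH // /den big_nil.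
Qed.

Lemma den_merge K (e : K -> K -> bool) (g : K -> V) s :
  (forall w w', e w w' -> w = w') -> den g (merge_fs e s) = den g s.
Proof.
move=> eP; elim: s => [//|[c w] s IH] /=; rewrite den_cons -IH.
case: (merge_fs e s) => [|[c' w'] r]; first by rewrite den_cons.
case: ifP => [/eP->|_]; last by rewrite den_cons.
rewrite den_cons addrA -scalerDl -intrD.
by case: eqP => [->|_]; rewrite ?den_cons // scale0r add0r.
Qed.

(** [sort] permutes its input for every relation [leT], in particular for the comparison of codes in
    [collect]. *)
Lemma big_sort T (leT : rel T) (s : seq T) (f : T -> V) :
  \sum_(x <- sort leT s) f x = \sum_(x <- s) f x.
Proof.
case: s => [//|x0 s']; set s := x0 :: s'.
case: (perm_iota_sort leT x0 s) => r pr ->.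
by rewrite big_map (perm_big _ pr) -[in RHS](mkseq_nth x0 s) /mkseq big_map.
Qed.

Lemma den_collect K (e : K -> K -> bool) code (g : K -> V) s :
  (forall w w', e w w' -> w = w') -> den g (collect e code s) = den g s.
Proof. by move=> eP; rewrite /collect den_merge // /den big_map big_sort big_map. Qed.
End Den.

Lemma eqlP l m : eql l m -> l = m.
Proof.
by case: l => [????|????????|????????]; case: m => [????|????????|????????] //=;
  do ?[case/andP=> /eqpP->]; move=> /eqpP->.
Qed.

Lemma eqsP K (e : K -> K -> bool) : (forall x y, e x y -> x = y) ->
  forall s t, eqs e s t -> s = t.
Proof. by move=> eP; elim=> [|x s IH] [|y t] //= /andP[/eP-> /IH->]. Qed.

(** * Alternated words and their canonical forms *)

Section Symbols.
Context {F : fieldType}.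
Implicit Type v : 'M[F]_(4, 8).

Definition ev v (l : letter) : nonzero F := reg (evl v l).

Definition altw v (w : seq letter) : tensor F := Alt8 (fun v => word (map (ev v) w)) v.

Lemma teq_Alt8 v (f g : 'M[F]_(4, 8) -> tensor F) :
  (forall s : 'S_8, tensor_eq (f (col_perm s v)) (g (col_perm s v))) ->
  tensor_eq (Alt8 f v) (Alt8 g v).
Proof. by move=> fg; apply: teq_sum => s _; apply: teqZ. Qed.

Lemma val_reg (x : F) : val (reg x) = if x == 0 then 1 else x.
Proof.
rewrite /reg; case: eqVneq => [->|x0]; last by rewrite insubdK.
by rewrite /insubd insubF //= eqxx.
Qed.

(** An element and its negative vanish together, so replacing 0 by 1 respects equality up to
    sign. *)
Lemma reg_pm (x y : F) : pm x y -> pm (val (reg x)) (val (reg y)).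
Proof.
rewrite !val_reg => -[->|->]; first by left.
by rewrite oppr_eq0; case: ifP => _; [left | right].
Qed.

(** Swapping two labels permutes two columns; reindexing the alternating sum by this transposition
    produces the sign. *)
Lemma altw_swap v i j w : ~~ eqp i j -> altw v (swapw w (i, j)) = - altw v w.
Proof.
move=> /eqpP ij; rewrite /altw /Alt8 -sumrN.
rewrite [RHS](reindex_inj (mulgI (tperm (ix i) (ix j)))) /=.
apply: eq_bigr => s _.
have t1 : ix i != ix j by apply: contra_notN ij => /eqP/ix_inj.
rewrite odd_permM odd_tperm t1 signr_addb mulN1r scaleNr opprK -map_comp col_permM.
by congr (_ *: word _); apply: eq_map => l; rewrite /= /ev evl_swap.
Qed.

Lemma altw_pm v (f g : letter -> letter) w :
  (forall (s : 'S_8) l, pm (evl (col_perm s v) (f l)) (evl (col_perm s v) (g l))) ->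
  tensor_eq (altw v (map f w)) (altw v (map g w)).
Proof.
move=> fg; apply: teq_Alt8 => s; rewrite -!map_comp.
by apply: (word_signs [::]) => l; apply: reg_pm.
Qed.

Lemma altw_normw v w : tensor_eq (altw v (normw w)) (altw v w).
Proof.
rewrite -[X in tensor_eq _ (altw v X)]map_id.
by apply: altw_pm => s l; apply: evl_norml.
Qed.

Lemma altw_variants v w u : List.In u (variants w) -> tensor_eq (altw v u) (altw v w).
Proof.
move=> uw; apply: teq_Alt8 => s; rewrite -[map _ u]cat0s -[map _ w]cat0s.
(* Generalising the empty prefix allows letters to be replaced one by one from the left. *)
move: (col_perm s v) [::] => {}v p; elim: w u uw p => [|l w IH] u /=.
  by case=> // <- p; apply: teq_refl.
move=> uw p.
have [m [u' [ml u'w ->]]] : exists m u',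
    [/\ List.In m (variants_l l), List.In u' (variants w) & u = m :: u'].
  elim: (variants_l l) uw => [//|m ms IHm] /=; rewrite List.in_app_iff => -[]; last first.
    by case/IHm=> m' [u' [? ? ?]]; exists m', u'; split=> //; right.
  by rewrite List.in_map_iff => -[u' [<- ?]]; exists m, u'; split=> //; left.
apply: teq_trans (word_sign p (map (ev v) u') (reg_pm (evl_variants v ml))) _.
by rewrite -!cat_rcons; apply: IH.
Qed.

Definition denc v (r : option signed_word) : tensor F :=
  if r is Some (b, w) then (-1) ^+ b *: altw v w else 0.

(** A swap of distinct labels negates the alternated word. If normalisation then gives the word
    back, it is its own negative, hence null; otherwise the signs of the sorting swaps multiply. *)
Lemma altw_canon1 v w : tensor_eq (altw v w) (denc v (canon1 w)).
Proof.
rewrite /canon1; case: (dup _) => [[i j]|].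
  case: ifP => /= [/andP[ij /(eqsP eqlP) wE]|_]; last by rewrite scale1r; apply: teq_refl.
  apply: teq_double0; rewrite -(altw_swap v w ij) -[X in tensor_eq (altw v X)]wE.
  exact: altw_normw.
rewrite /denc.
suff -> : altw v w = (-1) ^+ odd (size (swaps 8 (keys w))) *:
    altw v (foldl swapw w (swaps 8 (keys w))).
  by apply/teqZ/teq_sym/altw_normw.
have : all (fun ij => ~~ eqp ij.1 ij.2) (swaps 8 (keys w)).
  elim: 8%N (keys w) => [//|n IH] [//|[x k] t] /=.
  by case: ifP => xy //=; rewrite xy /=.
move: (swaps 8 (keys w)) => sw; elim: sw w => [|[i j] sw IH] w /=; first by rewrite scale1r.
case/andP=> ij /IH {}IH.
by rewrite signrN scaleNr -IH altw_swap ?opprK.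
Qed.

(** All candidates represent the same tensor [t], so any of them may be kept; one word with opposite
    signs forces [t] to be null. *)
Lemma altw_best v x rs t :
  tensor_eq t (denc v (Some x)) -> (forall r, List.In r rs -> tensor_eq t (denc v r)) ->
  tensor_eq t (denc v (best x rs)).
Proof.
elim: rs x => [//|[y|] rs IH] x tx trs; last by apply: (trs None); left.
have ty := trs _ (or_introl erefl).
have {}trs r : List.In r rs -> tensor_eq t (denc v r) by move=> ?; apply: trs; right.
rewrite /best -/best; case: ifP => [/(eqsP eqlP) xy|_]; last by apply: IH => //; case: ifP.
case: ifP => // xyb; last exact: IH.
apply: teq_double0; apply: teq_trans tx _.
have -> : denc v (Some x) = - denc v (Some y).
  case: x y xyb xy {ty} => b w [c u] /= bc ->.
  by rewrite -scaleNr -signrN; case: b c bc => -[].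
by rewrite -!scaleN1r; apply/teqZ/teq_sym.
Qed.

Lemma altw_canon v w : tensor_eq (altw v w) (denc v (canon w)).
Proof.
rewrite /canon.
have rsP r : List.In r [seq canon1 (normw u) | u <- variants w] ->
    tensor_eq (altw v w) (denc v r).
  rewrite List.in_map_iff => -[u [<- uw]].
  apply: teq_trans (teq_sym (altw_variants v uw)) _.
  exact: teq_trans (teq_sym (altw_normw v u)) (altw_canon1 v _).
case: [seq _ | u <- _] rsP => [|[x|] rs] rsP.
- by rewrite /= scale1r; apply: teq_refl.
- apply: altw_best; first by apply: rsP; left.
  by move=> r ?; apply: rsP; right.
- by apply: (rsP None); left.
Qed.

Lemma den_nf v s : tensor_eq (den (altw v) s) (den (altw v) (nf s)).
Proof.
rewrite /nf den_collect; last exact: eqsP eqlP.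
elim: s => [|[c w] s IH] /=; first exact: teq_refl.
have cw := altw_canon v w; rewrite den_cons /=.
case: (canon w) cw => [[b w']|] cw /=.
  rewrite den_cons /=; apply: teqD IH.
  by case: b cw => /(teqZ c%:~R); rewrite /= scalerA ?mulr1 // mulrN1 ?rmorphN.
rewrite -[X in tensor_eq _ X]add0r; apply: teqD IH.
by rewrite -(scaler0 _ c%:~R); apply: teqZ.
Qed.

End Symbols.

(** * Projector and symbol on formal sums *)

Section Soundness.
Context {F : fieldType}.
Implicit Type v : 'M[F]_(4, 8).

Lemma den_rcons K (f : K -> nonzero F) (b : bool) (s : fs (seq K)) c :
  den (fun u => word (map f u)) [seq ((-1) ^+ b * x.1, rcons x.2 c) | x <- s] =
  (-1) ^+ b *: tensor_rcons (den (fun u => word (map f u)) s) (f c).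
Proof.
rewrite /den big_map tensor_rcons_sum scaler_sumr; apply: eq_bigr => x _.
by rewrite /= rmorphM rmorph_sign -scalerA tensor_rcons_word map_rcons.
Qed.

Lemma den_rcons_sub K (f : K -> nonzero F) (s t : fs (seq K)) c d :
  den (fun u => word (map f u))
    ([seq (x.1, rcons x.2 c) | x <- s] ++ [seq (- x.1, rcons x.2 d) | x <- t]) =
  tensor_rcons (den (fun u => word (map f u)) s) (f c)
  - tensor_rcons (den (fun u => word (map f u)) t) (f d).
Proof.
have := den_rcons f false s c; rewrite scale1r => <-.
have := den_rcons f true t d; rewrite scaleN1r => <-; rewrite -den_cat.
by congr (den _ (_ ++ _)); apply: eq_map => x; rewrite ?mul1r ?mulN1r.
Qed.

Lemma den1 (V : lmodType rat) K (g : K -> V) w : den g [:: (1, w)] = g w.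
Proof. by rewrite /den big_seq1 scale1r. Qed.

Lemma Pi_rec_fPi K (f : K -> nonzero F) N w :
  Pi_rec N (map f w) = den (fun u => word (map f u)) (fPi N w).
Proof.
elim: N w => [|N IH] [|a [|b w]]; try by rewrite /fPi den1.
rewrite [RHS]/= den_rcons_sub -!IH /=.
by rewrite belast_map last_map.
Qed.

Lemma Alt8_den K (g : 'M[F]_(4, 8) -> K -> tensor F) (s : fs K) v :
  Alt8 (fun v => den (g v) s) v = den (fun w => Alt8 (g^~ w) v) s.
Proof.
rewrite /Alt8 /den; under eq_bigr do rewrite scaler_sumr.
rewrite exchange_big; apply: eq_bigr => x _ /=.
by rewrite scaler_sumr; apply: eq_bigr => t _; rewrite !scalerA mulrC.
Qed.

(** The projector permutes tensor positions and the alternation permutes vectors, so the two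
    commute. *)
Lemma Pi_sh_den v s : Pi_sh (den (altw v) s) = den (altw v) (fPi_fs s).
Proof.
rewrite den_flatten big_map Pi_sh_sum; apply: eq_bigr => x _ /=.
rewrite den_scale -[den _ _](Alt8_den (fun v w => word (map (ev v) w))).
rewrite /altw /Alt8 Pi_sh_sum; congr (_ *: _); apply: eq_bigr => t _.
by rewrite Pi_sh_word size_map Pi_rec_fPi.
Qed.

(** The condition on [PO] makes the default values of the two [nth] agree. *)
Lemma symbol_fsymb (val : point -> F) N a0 s a1 : val PO = 0 ->
  symbol_II N (val a0) (map val s) (val a1) =
  den (fun u => word (map (fun ij => reg (val ij.1 - val ij.2)) u)) (fsymb N a0 s a1).
Proof.
move=> val0.
have nthv l k : nth 0 (map val l) k = val (nth PO l k) by elim: l k => [|x l IH] [|k] /=.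
elim: N s => [|N IH] s; first by rewrite /= den1.
have io : iota 0 N.+1 = index_iota 0 N.+1 by rewrite /index_iota subn0.
rewrite /fsymb -/fsymb io den_flatten big_map big_mkord /=.
apply: eq_bigr => i _; rewrite den_rcons_sub /= -IH map_cat map_take map_drop.
by rewrite -map_rcons -map_cons !nthv.
Qed.

(** Factorisation modulo torsion, stated inside an arbitrary tensor slot, which is how it is
    substituted into words. *)
Definition isfact v (x : nonzero F) (f : fact) : Prop :=
  forall p q, tensor_eq (word (p ++ x :: q)) (den (fun l => word (p ++ ev v l :: q)) f).

Lemma word_expand v K (g : K -> nonzero F) (d : K -> fact) (u : seq K) :
  (forall a, isfact v (g a) (d a)) ->
  tensor_eq (word (map g u)) (den (fun w => word (map (ev v) w)) (expand (map d u))).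
Proof.
move=> gd; rewrite -[map g u]cat0s.
suff H p : tensor_eq (word (p ++ map g u))
    (den (fun w => word (p ++ map (ev v) w)) (expand (map d u))) by apply: H.
elim: u p => [|a u IH] p /=; first by rewrite den1 /=; apply: teq_refl.
apply: teq_trans (gd a p _) _; rewrite den_flatten big_map; apply: teq_sum => c _.
have -> : den (fun w => word (p ++ map (ev v) w))
      [seq (c.1 * x.1, c.2 :: x.2) | x <- expand (map d u)] =
    c.1%:~R *: den (fun w => word (rcons p (ev v c.2) ++ map (ev v) w)) (expand (map d u)).
  rewrite /den big_map scaler_sumr; apply: eq_bigr => x _.
  by rewrite /= rmorphM scalerA cat_rcons.
by apply: teqZ; rewrite -cat_rcons; apply: IH.
Qed.

Lemma symbol_U a0 s a1 : symbol (@II F a0 s a1) = symbol_II (size s) a0 s a1.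
Proof. exact: lin_extU. Qed.

(** The same factorisations [d] hold at every permuted configuration, so the alternation can be
    taken over the formal words. *)
Lemma Alt8_symbol v (val : 'M[F]_(4, 8) -> point -> F) (d : point * point -> fact) a0 s a1 :
  (forall v, val v PO = 0) ->
  (forall (t : 'S_8) a, isfact (col_perm t v)
     (reg (val (col_perm t v) a.1 - val (col_perm t v) a.2)) (d a)) ->
  tensor_eq (Alt8 (fun v => symbol (II (val v a0) (map (val v) s) (val v a1))) v)
    (den (altw v) (expand_fs d (fsymb (size s) a0 s a1))).
Proof.
move=> val0 vald.
have -> : Alt8 (fun v => symbol (II (val v a0) (map (val v) s) (val v a1))) v =
    den (fun u => Alt8 (fun v => word (map (fun ij => reg (val v ij.1 - val v ij.2)) u)) v)
      (fsymb (size s) a0 s a1).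
  by rewrite -Alt8_den /Alt8; apply: eq_bigr => t _; rewrite symbol_U size_map symbol_fsymb.
rewrite den_flatten big_map; apply: teq_sum => x _.
apply: teq_trans (den_nf _ _); rewrite den_scale; apply: teqZ.
rewrite -[den _ _](Alt8_den (fun v w => word (map (ev v) w))).
by apply: teq_Alt8 => t; apply: word_expand.
Qed.

(** * Arithmetic of factorisations *)

Section Facts.
Variable v : 'M[F]_(4, 8).

(** Nonvanishing is carried along because [reg] respects products only of nonzero elements. *)
Definition fac (x : F) (f : fact) : Prop := x != 0 /\ isfact v (reg x) f.

Lemma isfact1 : isfact v (reg 1) [::].
Proof.
move=> p q; rewrite /den big_nil; apply: word_root1; left.
by rewrite val_reg oner_eq0.
Qed.

Lemma isfact0 : isfact v (reg 0) [::].
Proof.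
by move=> p q; rewrite /den big_nil; apply: word_root1; left; rewrite val_reg eqxx.
Qed.

Lemma isfactN x f : isfact v (reg x) f -> isfact v (reg (- x)) f.
Proof.
move=> xf p q; apply: teq_trans (xf p q).
by apply: word_sign; apply: reg_pm; right.
Qed.

Lemma facN x f : fac x f -> fac (- x) f.
Proof. by case=> x0 /isfactN; rewrite /fac oppr_eq0. Qed.

Lemma facM x y f g : fac x f -> fac y g -> fac (x * y) (f ++ g).
Proof.
case=> x0 xf [y0 yg]; split=> [|p q]; first by rewrite mulf_neq0.
rewrite den_cat; apply: teq_trans (teqD (xf p q) (yg p q)).
by apply: word_mul; rewrite !val_reg mulf_eq0 (negPf x0) (negPf y0).
Qed.

(** Multiplicativity is applied to x * x^-1 = 1, and a word with entry 1 is null. *)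
Lemma facV x f : fac x f -> fac x^-1 (fN f).
Proof.
case=> x0 xf; split=> [|p q]; first by rewrite invr_eq0.
rewrite den_scale; apply: teq_trans (teqZ _ (xf p q)).
have := @word_mul _ p q (reg x) (reg x^-1) (reg 1).
rewrite !val_reg invr_eq0 oner_eq0 (negPf x0) mulfV // => /(_ erefl) h.
have := isfact1 p q; rewrite /den big_nil => /teq_sym h1.
have {h h1} := teq_trans h1 h; rewrite /tensor_eq sub0r => /(tensor_nullZ (-1)).
by rewrite scaleN1r opprK addrC rmorphN scaleN1r opprK.
Qed.

Lemma fac_simp x f : fac x f -> fac x (simp f).
Proof. by case=> x0 xf; split=> // p q; rewrite den_collect //; apply: eqlP. Qed.

Lemma fac_prod s : all (fun l => evl v l != 0) s ->
  fac (\prod_(l <- s) evl v l) [seq (1, l) | l <- s].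
Proof.
elim: s => [_|l s IH] /=.
  by rewrite big_nil; split; [apply: oner_neq0 | apply: isfact1].
case/andP=> l0 /IH sf; rewrite big_cons -cat1s; apply: facM sf; split=> // p q.
by rewrite den1; apply: teq_refl.
Qed.

Lemma fac_quo s t x : all (fun l => evl v l != 0) s -> all (fun l => evl v l != 0) t ->
  x = (\prod_(l <- s) evl v l) / (\prod_(l <- t) evl v l) -> fac x (quo s t).
Proof.
move=> s0 t0 ->; have := facM (fac_prod s0) (facV (fac_prod t0)).
by rewrite /fN /fscale -map_comp.
Qed.

(** One difference of each opposite pair suffices, as signs are torsion; equal points give 0, which
    [reg] replaces by 1. *)
Lemma isfact_table x y fx fy fx' fy' fxy :
  isfact v (reg x) fx -> isfact v (reg y) fy -> isfact v (reg (1 - x)) fx' ->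
  isfact v (reg (1 - y)) fy' -> isfact v (reg (x - y)) fxy ->
  let val (a : point) := match a with PO => 0 | PI => 1 | PX => x | PY => y end in
  forall a, isfact v (reg (val a.1 - val a.2)) (table fx fy fx' fy' fxy a).
Proof.
move=> hx hy hx' hy' hxy val.
have h0 := isfact0; have h1 := isfact1.
have sub z t f : isfact v (reg (z - t)) f -> isfact v (reg (t - z)) f.
  by move/isfactN; rewrite opprB.
have neg z f : isfact v (reg z) f -> isfact v (reg (0 - z)) f.
  by rewrite sub0r; exact: isfactN.
case=> [[] []]; rewrite /val /table ?subrr ?subr0.
- exact: h0. - exact/neg/h1. - exact/neg/hx. - exact/neg/hy.
- exact: h1. - exact: h0. - exact: hx'. - exact: hy'.
- exact: hx. - exact/sub/hx'. - exact: h0. - exact: hxy.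
- exact: hy. - exact/sub/hy'. - exact/sub/hxy. - exact: h0.
Qed.
End Facts.
End Soundness.

(** * The symbols of the two sides *)

Section Configuration.
Context {F : fieldType}.
Variable v : 'M[F]_(4, 8).
Hypothesis v_good : good v.

Let x1 := rhoB v 1 2 * rhoB v 3 4 / (rhoB v 3 2 * rhoB v 1 4).
Let y1 := rho v 1 / rhoB v 1 4.
Let x2 := rhoB v 1 2 / rho v 1.
Let y2 := rhoB v 3 2 / rhoB v 3 4.
Let z3 := rho v 1 * rhoB v 3 2 / (rhoB v 1 2 * rhoB v 3 4).

Lemma fac_rho : [/\ fac v (rho v 1) r1, fac v (rho v 2) r2 & fac v (rho v 4) r4].
Proof.
have /and5P[? ? ? ? /and5P[? ? ? ? _]] := v_good.
by split; apply: fac_quo; rewrite /= ?andbT // !big_seq1.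
Qed.

Lemma fac_sub (n d m e : letter) s x :
  x = evl v n / evl v d - evl v m / evl v e -> evl v d != 0 -> evl v e != 0 ->
  all (fun l => evl v l != 0) s ->
  evl v n * evl v e - evl v d * evl v m = \prod_(l <- s) evl v l ->
  fac v x (quo s [:: d; e]).
Proof.
move=> -> d0 e0 s0 nm; apply: fac_quo; rewrite //= ?d0 ?e0 //.
by rewrite -nm !big_cons big_nil mulr1; field; rewrite ?d0 ?e0.
Qed.

Lemma fac_rhoB : [/\ fac v (rhoB v 1 2) r12, fac v (rhoB v 3 2) r32, fac v (rhoB v 3 4) r34 &
  fac v (rhoB v 1 4) r14].
Proof.
have := v_good.
case/and5P=> ? ? ? ? /and5P[? ? ? ? /and5P[X1 X2 X3 X4 /and5P[X5 X6 ? ? /and3P[X7 _ _]]]].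
have C a b c d : br v b c a d = br v a b c d by rewrite !brE /minor2; ring.
split.
- apply: (fac_sub (n := n1) (m := n2)) => //; first by rewrite /= X1 X2.
  (* With 2 and 3 fixed the relation reads <1237><2348> - <1238><2347> = <1234><2378>; [C] rotates
     <231x> into <123x>. *)
  have := br_plucker v p2 p3 p1 p4 p7 p8; rewrite !(C p1 p2 p3) => h.
  by rewrite !big_cons big_nil mulr1 -[RHS]subr0 -h /evl /=; ring.
- rewrite /rhoB -opprB; apply: facN.
  apply: (fac_sub (n := n2) (m := n3)) => //; first by rewrite /= X3 X4.
  have := br_plucker v p3 p4 p2 p5 p7 p8; rewrite !(C p2 p3 p4) => h.
  by rewrite !big_cons big_nil mulr1 -[RHS]subr0 -h /evl /=; ring.
- apply: (fac_sub (n := n3) (m := n4)) => //; first by rewrite /= X5 X6.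
  have := br_plucker v p4 p5 p3 p6 p7 p8; rewrite !(C p3 p4 p5) => h.
  by rewrite !big_cons big_nil mulr1 -[RHS]subr0 -h /evl /=; ring.
- apply: (fac_sub (n := n1) (m := n4)) => //; first by rewrite /= X7.
  by rewrite big_seq1.
Qed.

Lemma fac_rhoB13 : fac v (rhoB v 1 3) r13.
Proof.
have /and5P[? ? ? ? /and5P[? ? ? ? /and5P[? ? ? ? /and5P[? ? X _ _]]]] := v_good.
by apply: (fac_sub (n := n1) (m := n3)) => //; rewrite ?big_seq1 //= X.
Qed.

Lemma fac_rhoB24 : fac v (rhoB v 2 4) r24.
Proof.
have /and5P[? ? ? ? /and5P[? ? ? ? /and5P[? ? ? ? /and5P[? ? _ X _]]]] := v_good.
by apply: (fac_sub (n := n2) (m := n4)) => //; rewrite ?big_seq1 //= X.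
Qed.

(** The terms rho_1 rho_3 cancel, so over the common denominator exactly the four monomials of [Lp]
    remain. *)
Lemma fac_rhoP : fac v (rhoB v 1 2 * rhoB v 3 4 - rho v 1 * rhoB v 3 2) rP.
Proof.
have := v_good.
case/and5P=> ? ? ? ? /and5P[d10 d20 d30 d40 /and5P[? ? ? ? /and5P[? ? ? ? /and3P[_ X _]]]].
apply: fac_quo; rewrite /= ?andbT //; first exact/and4P.
rewrite !big_cons !big_nil !mulr1.
have -> : rhoB v 1 2 = evl v n1 / evl v d1 - evl v n2 / evl v d2 by [].
have -> : rhoB v 3 4 = evl v n3 / evl v d3 - evl v n4 / evl v d4 by [].
have -> : rhoB v 3 2 = evl v n3 / evl v d3 - evl v n2 / evl v d2 by [].
have -> : rho v 1 = evl v n1 / evl v d1 by [].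
have -> : evl v (Lp p1 p2 p3 p4 p5 p6 p7 p8) =
    evl v n1 * evl v n2 * evl v d3 * evl v d4 - evl v n1 * evl v d2 * evl v d3 * evl v n4
    + evl v d1 * evl v n2 * evl v d3 * evl v n4 - evl v d1 * evl v n2 * evl v n3 * evl v d4.
  by [].
by field; rewrite ?d10 ?d20 ?d30 ?d40.
Qed.

Lemma facE x y f : fac v y f -> x = y -> isfact v (reg x) (simp f).
Proof. by move=> /fac_simp[_ yf] ->. Qed.

Definition val1 (a : point) : F := match a with PO => 0 | PI => 1 | PX => x1 | PY => y1 end.
Definition val2 (a : point) : F := match a with PO => 0 | PI => 1 | PX => x2 | PY => y2 end.
Definition val3 (a : point) : F := match a with PO => 0 | PI => 1 | PX => z3 | PY => 0 end.

Lemma isfact_tab1 a : isfact v (reg (val1 a.1 - val1 a.2)) (tab1 a).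
Proof.
have [f1 f2 f4] := fac_rho; have [f12 f32 f34 f14] := fac_rhoB.
have f13 := fac_rhoB13; have f24 := fac_rhoB24; have fP := fac_rhoP.
have [h32 _] := f32; have [h14 _] := f14.
apply: isfact_table; rewrite /x1 /y1.
- by apply: facE (facM (facM f12 f34) (facV (facM f32 f14))) _.
- by apply: facE (facM f1 (facV f14)) _.
(* The cross-ratio identity rho_(3,2) rho_(1,4) - rho_(1,2) rho_(3,4) = - rho_(1,3) rho_(2,4). *)
- apply: facE (facN (facM f13 (facM f24 (facV (facM f32 f14))))) _.
  by move: h32 h14; rewrite /rhoB => *; field; apply/andP.
- apply: facE (facN (facM f4 (facV f14))) _.
  by move: h14; rewrite /rhoB => *; field.
- apply: facE (facM fP (facV (facM f32 f14))) _.
  by move: h32 h14 => *; field; apply/andP.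
Qed.

Lemma isfact_tab2 a : isfact v (reg (val2 a.1 - val2 a.2)) (tab2 a).
Proof.
have [f1 f2 f4] := fac_rho; have [f12 f32 f34 f14] := fac_rhoB.
have f24 := fac_rhoB24; have fP := fac_rhoP.
have [h34 _] := f34; have [h1 _] := f1.
apply: isfact_table; rewrite /x2 /y2.
- by apply: facE (facM f12 (facV f1)) _.
- by apply: facE (facM f32 (facV f34)) _.
- apply: facE (facM f2 (facV f1)) _.
  by move: h1; rewrite /rhoB => *; field.
- apply: facE (facM f24 (facV f34)) _.
  by move: h34; rewrite /rhoB => *; field.
- apply: facE (facM fP (facV (facM f1 f34))) _.
  by move: h1 h34 => *; field; apply/andP.
Qed.

Lemma isfact_tab3 a : isfact v (reg (val3 a.1 - val3 a.2)) (tab3 a).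
Proof.
have [f1 f2 f4] := fac_rho; have [f12 f32 f34 f14] := fac_rhoB; have fP := fac_rhoP.
have [h12 _] := f12; have [h34 _] := f34.
have zf : isfact v (reg z3) (simp (r1 ++ r32 ++ fN (r12 ++ r34))).
  by apply: facE (facM f1 (facM f32 (facV (facM f12 f34)))) _; rewrite mulrA.
apply: isfact_table => //; rewrite ?subr0.
- exact: isfact0.
- apply: facE (facM fP (facV (facM f12 f34))) _.
  by move: h12 h34; rewrite /z3 => *; field; apply/andP.
- exact: isfact1.
- exact: zf.
Qed.
End Configuration.

(** * Linearity of alternation and symbol, and the final comparison *)

Section Alternation.
Context {F : fieldType} {V : lmodType rat}.
Implicit Types (f g : 'M[F]_(4, 8) -> V) (v : 'M[F]_(4, 8)).

Lemma Alt8D f g v : Alt8 (fun v => f v + g v) v = Alt8 f v + Alt8 g v.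
Proof. by rewrite /Alt8 -big_split; apply: eq_bigr => s _; rewrite scalerDr. Qed.

Lemma Alt8Z c f v : Alt8 (fun v => c *: f v) v = c *: Alt8 f v.
Proof. by rewrite /Alt8 scaler_sumr; apply: eq_bigr => s _; rewrite !scalerA mulrC. Qed.

End Alternation.

Lemma symbol_Alt8 (F : fieldType) (f : 'M[F]_(4, 8) -> polylog F) v :
  symbol (Alt8 f v) = Alt8 (fun v => symbol (f v)) v.
Proof. by rewrite /symbol /Alt8 linear_sum; apply: eq_bigr => s _; rewrite linearZ. Qed.

Lemma symbolD (F : fieldType) (A B : polylog F) : symbol (A + B) = symbol A + symbol B.
Proof. exact: linearD. Qed.

Lemma symbolN (F : fieldType) (A : polylog F) : symbol (- A) = - symbol A.
Proof. exact: linearN. Qed.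

Lemma symbolZ (F : fieldType) c (A : polylog F) : symbol (c *: A) = c *: symbol A.
Proof. exact: linearZ. Qed.

Lemma den_formal_difference (V : lmodType rat) (g : seq letter -> V) :
  den g formal_difference = (56 : int)%:~R *: g Gr4_word
    + (-1) *: (den g (expand_fs tab1 I31_word) + (2 *: den g (expand_fs tab2 I31_word)
         - 6 *: den g (expand_fs tab3 Li4_word))).
Proof.
rewrite /formal_difference.
(* Generalising over the three expansions keeps them from being unfolded. *)
move: (expand_fs tab1 _) (expand_fs tab2 _) (expand_fs tab3 _) => s t u.
rewrite den_cons !den_cat !den_scale.
by rewrite !rmorphN rmorph1 !scaleN1r !scaleNr !opprD opprK.
Qed.

Theorem theorem4p1 (R : realType) :
  eq_sh
    ((7 / 144 : rat) *: Gr4 (generic_config R))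
    (Alt8 (fun v =>
        I31 (rhoB v 1 2 * rhoB v 3 4 / (rhoB v 3 2 * rhoB v 1 4))
            (rho v 1 / rhoB v 1 4)
        + (2 : rat) *: I31 (rhoB v 1 2 / rho v 1) (rhoB v 3 2 / rhoB v 3 4)
        + (6 : rat) *: Li4 (rho v 1 * rhoB v 3 2 / (rhoB v 1 2 * rhoB v 3 4)))
      (generic_config R)).
Proof.
set v0 := generic_config R; rewrite /eq_sh /symbol_sh.
pose integral (val : point -> config_field R) a0 s a1 := II (val a0) (map val s) (val a1).
set L := symbol _; set A := Alt8 _ _.
have good_v0 (s : 'S_8) : good (col_perm s v0) by apply: good_generic.
have LE : L = (56 : int)%:~R *: altw v0 Gr4_word.
  rewrite /L symbolZ /symbol lin_extU /symbol_Gr4 scalerA.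
  by congr (_ *: _).
have AE : tensor_eq (symbol A)
    (den (altw v0) (expand_fs tab1 I31_word)
     + (2 *: den (altw v0) (expand_fs tab2 I31_word)
        - 6 *: den (altw v0) (expand_fs tab3 Li4_word))).
  (* Each term is an iterated integral at the points [val1], [val2] or [val3]; the sign in [Li4]
     gives the coefficient -6. *)
  have -> : symbol A =
      Alt8 (fun v => symbol (integral (val1 v) PO [:: PX; PO; PO; PY] PI)) v0
      + (2 *: Alt8 (fun v => symbol (integral (val2 v) PO [:: PX; PO; PO; PY] PI)) v0
         - 6 *: Alt8 (fun v => symbol (integral (val3 v) PO [:: PI; PO; PO; PO] PX)) v0).
    rewrite symbol_Alt8 -scaleNr -!Alt8Z -!Alt8D; apply: eq_bigr => s _; congr (_ *: _).
    by rewrite !symbolD !symbolZ [symbol (Li4 _)]symbolN scalerN -scaleNr -addrA.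
  apply: teqD; first by apply: (Alt8_symbol (val := val1)) => // t a; apply: isfact_tab1.
  apply: teqD; first apply: teqZ.
    by apply: (Alt8_symbol (val := val2)) => // t a; apply: isfact_tab2.
  rewrite -!scaleNr; apply: teqZ.
  by apply: (Alt8_symbol (val := val3)) => // t a; apply: isfact_tab3.
(* By linearity of [Pi_sh] both symbols can be compared as one formal sum. *)
suff : tensor_eq (Pi_sh (L - symbol A)) 0 by rewrite Pi_shB /tensor_eq subr0.
apply: teq_trans (_ : tensor_eq _ (Pi_sh (den (altw v0) (nf formal_difference)))) _.
  apply: teq_Pi_sh; apply: teq_trans (den_nf _ _).
  rewrite LE den_formal_difference; apply: teqD (teq_refl _) _.
  by rewrite -[- symbol A]scaleN1r; apply: teqZ AE.
rewrite Pi_sh_den; apply: teq_trans (den_nf _ _) _.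
by case: (nf _) formal_difference_vanishes => // _; rewrite /den big_nil; apply: teq_refl.
Qed.
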